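(* Let $\mathcal{A}$ be a unital $C^*$-algebra, $a\in \mathcal{A}$ and $f\in S(\mathcal{A})$. Then $$|f(a)|^2 \leq f\left( t\left( \frac{|a|+ |a^*|}{2} \right)^2 + (1-t) |a|^2 \right) \quad \text{ for all } t\in [0,1].$$ Furthermore, for all $t\in[0,1]$, $$v^{2}(a) \leq \left\| t\left(\frac{|a|+|a^*|}{2} \right)^2 +(1-t) |a|^{2} \right\|$$ and $$v^{2}(a) \leq \left\| t\left(\frac{|a|+|a^*|}{2} \right)^2 +(1-t) |a^*|^{2} \right\| .$$ In particular, for $t=1$, $$v^2(a) \leq \frac{1}{2}\left\| Re(|a||a^*|)\right\|+\frac14 \left\| a^*a+aa^* \right\| \leq \frac{1}{2}v\left( |a||a^*| \right)+\frac14 \left\| a^*a+aa^* \right\|.$$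
   Context: $\mathcal{A}$ is a unital $C^*$-algebra with unit $e$. $S(\mathcal{A})$ is the set of normalized states, i.e. continuous linear functionals $f$ on $\mathcal{A}$ with $f(e)=\|f\|=1$ (equivalently, positive linear functionals with $f(e)=1$). The algebraic numerical radius of $a$ is $v(a)=\sup\{|f(a)|: f\in S(\mathcal{A})\}$, and $v^2(a)$ means $(v(a))^2$. $|a|=(a^*a)^{1/2}$, so $|a^*|=(aa^* )^{1/2}$. $Re(a)=\frac12(a+a^* )$. *)

(* Defs.v *)
From HB Require Import structures.
From mathcomp Require Import all_boot all_order all_algebra complex.
From mathcomp Require Import boolp classical_sets functions reals topology.
From mathcomp Require Import normedtype.

Set Implicit Arguments.
Unset Strict Implicit.
Unset Printing Implicit Defensive.

Import Order.TTheory GRing.Theory Num.Theory.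
Import numFieldNormedType.Exports.

Local Open Scope classical_set_scope.
Local Open Scope complex_scope.
Local Open Scope ring_scope.

(* The product is a field of the mixin because HB does not accept a structure
   that joins rings and normed modules; the algebra structure is recovered
   below as an instance, so that [1], [*] and [^+] are the usual operations of
   an algType. The zero algebra, which has no state, is excluded. *)
HB.mixin Record isCStarAlgebra (R : realType) (A : Type)
    & CompleteNormedModule R[i] A := {
  cstar_one : A ;
  cstar_mul : A -> A -> A ;
  star : A -> A ;
  cstar_mulA : associative cstar_mul ;
  cstar_mul1x : left_id cstar_one cstar_mul ;
  cstar_mulx1 : right_id cstar_one cstar_mul ;
  cstar_mulDl : left_distributive cstar_mul +%R ;
  cstar_mulDr : right_distributive cstar_mul +%R ;
  cstar_one_neq0 : cstar_one != 0 ;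
  cstar_scaleAl : forall (k : R[i]) (x y : A),
    k *: cstar_mul x y = cstar_mul (k *: x) y ;
  cstar_scaleAr : forall (k : R[i]) (x y : A),
    k *: cstar_mul x y = cstar_mul x (k *: y) ;
  cstar_normM : forall x y : A, `|cstar_mul x y| <= `|x| * `|y| ;
  starK : involutive star ;
  starD : {morph star : x y / x + y} ;
  starZ : forall (k : R[i]) (x : A), star (k *: x) = conjc k *: star x ;
  star_mul : forall x y : A,
    star (cstar_mul x y) = cstar_mul (star y) (star x) ;
  cstar_norm : forall x : A, `|cstar_mul (star x) x| = `|x| ^+ 2
}.

#[short(type="cstarAlgType")]
HB.structure Definition CStarAlgebra (R : realType) :=
  {A of CompleteNormedModule R[i] A & isCStarAlgebra R A}.

#[non_forgetful_inheritance]
HB.instance Definition _ (R : realType) (A : cstarAlgType R) :=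
  GRing.Zmodule_isNzRing.Build A (@cstar_mulA R A) (@cstar_mul1x R A)
    (@cstar_mulx1 R A) (@cstar_mulDl R A) (@cstar_mulDr R A)
    (@cstar_one_neq0 R A).

#[non_forgetful_inheritance]
HB.instance Definition _ (R : realType) (A : cstarAlgType R) :=
  GRing.Lmodule_isLalgebra.Build R[i] A (@cstar_scaleAl R A).

#[non_forgetful_inheritance]
HB.instance Definition _ (R : realType) (A : cstarAlgType R) :=
  GRing.Lalgebra_isAlgebra.Build R[i] A (@cstar_scaleAr R A).

(* The norm of a normed module over R[i] is R[i]-valued (with nonnegative real
   values); [rnorm] is the same norm as an element of R. *)
Definition rnorm (R : realType) (V : normedModType R[i]) (x : V) : R :=
  complex.Re `|x|.

Section CStarDefs.
Variables (R : realType) (A : cstarAlgType R).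
Implicit Types (a b : A) (f : {linear A -> R[i]^o}).

Definition dual_norm f : R :=
  sup [set rnorm (f x) | x in [set x | rnorm x <= 1]].

Definition states : set {linear A -> R[i]^o} :=
  [set f : {linear A -> R[i]^o} |
    [/\ continuous f, f 1 = 1 & dual_norm f = 1]].

Definition alg_numerical_radius a : R := sup [set rnorm (f a) | f in states].

Definition cstar_pos a : Prop := exists b, a = star b * b.

(* The positive square root, which exists and is unique for positive [a];
   0 is a junk value when [a] has no positive square root. *)
Definition cstar_sqrt a : A := xget 0 [set b | cstar_pos b /\ b ^+ 2 = a].

Definition cstar_abs a : A := cstar_sqrt (star a * a).

Definition re_part a : A := 2^-1 *: (a + star a).

End CStarDefs.

(* Main.v *)
(* Everything is derived from the C*-identity, without functional calculus.
   The cone [pos] of self-adjoint h with |r - h| <= r for some r > 0 consists of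
   the squares of self-adjoint elements, square roots being given by the binomial
   series; by the theorem of Fukamiya and Kaplansky it contains every [a^* a].

   With h = |a| and k = |a^*| one has a h = k a, which yields
   a + a^* <= h + k + eps from the positivity of (a g^-1 - 1) g (a g^-1 - 1)^*
   for g = h + eps. Replacing a by a multiple of modulus 1, every state f
   satisfies |f a| <= f ((h + k) / 2), and Kadison's inequality
   |f y|^2 <= f (y^* y), for y = (h + k) / 2 and for y = a, gives the first bound;
   the next two follow by taking suprema. The last bound expands (h + k)^2 as
   a^* a + a a^* + 2 Re (h k), and uses that the norm of a self-adjoint element is
   attained by a state (Hahn-Banach). *)
Require Import Defs.
From HB Require Import structures.
From mathcomp Require Import all_boot all_order all_algebra complex.
From mathcomp Require Import boolp classical_sets functions reals topology.
From mathcomp Require Import normedtype.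
From mathcomp Require Import sequences.
From mathcomp Require Import ring lra.

Set Implicit Arguments.
Unset Strict Implicit.
Unset Printing Implicit Defensive.

Import Order.TTheory GRing.Theory Num.Theory.
Import numFieldNormedType.Exports.

Local Open Scope classical_set_scope.
Local Open Scope complex_scope.
Local Open Scope ring_scope.

(** * The imaginary unit *)

Section ComplexUnit.
Variable R : realType.

Lemma mulii : 'i%C * 'i%C = -1 :> R[i].
Proof. by rewrite -expr2 sqr_i. Qed.

Lemma conjc_i : conjc 'i%C = - 'i%C :> R[i].
Proof. by apply/eqP; rewrite eq_complex /= oppr0 !eqxx. Qed.

End ComplexUnit.

(** * Real-valued norms *)

Section RealNorm.
Variables (R : realType) (V : normedModType R[i]).
Implicit Types x y : V.

Lemma normE x : `|x| = (rnorm x)%:C.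
Proof. by rewrite /rnorm RRe_real // normr_real. Qed.

Lemma rnorm_ge0 x : 0 <= rnorm x.
Proof. by rewrite -ler0c -normE. Qed.

Lemma rnorm_eq0 x : (rnorm x == 0) = (x == 0).
Proof. by rewrite -(normr_eq0 x) normE -(inj_eq (@complexI R)). Qed.

Lemma rnorm0 : rnorm (0 : V) = 0.
Proof. by apply/eqP; rewrite rnorm_eq0. Qed.

Lemma rnormN x : rnorm (- x) = rnorm x.
Proof. by rewrite /rnorm normrN. Qed.

Lemma rnormB x y : rnorm (x - y) = rnorm (y - x).
Proof. by rewrite -rnormN opprB. Qed.

Lemma rnormD x y : rnorm (x + y) <= rnorm x + rnorm y.
Proof. by rewrite -lecR rmorphD /= -!normE ler_normD. Qed.

Lemma rnormZ (k : R[i]) x : rnorm (k *: x) = complex.Re `|k| * rnorm x.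
Proof.
by apply: complexI; rewrite -normE normrZ (normE x) rmorphM /= RRe_real ?normr_real.
Qed.

Lemma rnormZr (r : R) x : rnorm (r%:C *: x) = `|r| * rnorm x.
Proof. by rewrite rnormZ normc_def /= expr0n addr0 sqrtr_sqr. Qed.

End RealNorm.

(** * Real scalars, the involution and the C*-identity *)

Section Basics.
Variables (R : realType) (A : cstarAlgType R).
Implicit Types (x y z : A) (r : R).

Definition rl r : A := r%:C%:A.

Lemma rl_is_additive : {morph rl : r s / r - s}.
Proof. by move=> r s; rewrite /rl rmorphB /= scalerBl. Qed.

Lemma rl_is_multiplicative : multiplicative rl.
Proof.
by split=> [r s|]; rewrite /rl ?rmorphM /= ?scale1r // -scalerAl mul1r scalerA.
Qed.

HB.instance Definition _ := GRing.isAdditive.Build R A rl rl_is_additive.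
HB.instance Definition _ :=
  GRing.isMultiplicative.Build R A rl rl_is_multiplicative.

Lemma mul_rl r x : rl r * x = r%:C *: x.
Proof. by rewrite -scalerAl mul1r. Qed.

Lemma rlC r x : GRing.comm x (rl r).
Proof. by rewrite /GRing.comm mul_rl -scalerAr mulr1. Qed.

Lemma starM x y : star (x * y) = star y * star x.
Proof. exact: star_mul. Qed.

Lemma star0 : star (0 : A) = 0.
Proof. by have := starD (0 : A) 0; rewrite addr0 -[LHS]addr0 => /addrI. Qed.

Lemma starN x : star (- x) = - star x.
Proof. by apply/eqP; rewrite -addr_eq0 -starD addNr star0. Qed.

Lemma starB x y : star (x - y) = star x - star y.
Proof. by rewrite starD starN. Qed.

Lemma star1 : star (1 : A) = 1.
Proof. by rewrite -[LHS]mulr1 -[X in _ * X]starK -starM mulr1 starK. Qed.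

Lemma starX x n : star (x ^+ n) = star x ^+ n.
Proof. by elim: n => [|n IH]; rewrite ?expr0 ?star1 // exprS starM IH exprSr. Qed.

Lemma star_rl r : star (rl r) = rl r.
Proof. by rewrite /rl starZ star1 conjc_real. Qed.

Lemma rnormM x y : rnorm (x * y) <= rnorm x * rnorm y.
Proof. by rewrite -lecR rmorphM /= -!normE; exact: cstar_normM. Qed.

Lemma rnorm_cstar x : rnorm (star x * x) = rnorm x ^+ 2.
Proof. by apply: complexI; rewrite rmorphXn /= -!normE; exact: cstar_norm. Qed.

(** [|y|^2 = |y^* y| <= |y^*| |y|]; cancel [|y|], then use this for [x] and for its adjoint. *)
Lemma rnorm_star x : rnorm (star x) = rnorm x.
Proof.
suff le_star y : rnorm y <= rnorm (star y).
  by apply/eqP; rewrite eq_le le_star -{2}(starK x) le_star.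
have [->|y0] := eqVneq y 0; first by rewrite star0.
have yp : 0 < rnorm y by rewrite lt_def rnorm_eq0 y0 rnorm_ge0.
by rewrite -(ler_pM2r yp) -expr2 -rnorm_cstar rnormM.
Qed.

Lemma rnorm_sa x : star x = x -> rnorm (x ^+ 2) = rnorm x ^+ 2.
Proof. by move=> sx; rewrite -rnorm_cstar sx. Qed.

Lemma rnorm1 : rnorm (1 : A) = 1.
Proof.
have n1 : rnorm (1 : A) != 0 by rewrite rnorm_eq0 oner_neq0.
by apply: (mulfI n1); rewrite mulr1 -expr2 -rnorm_sa ?star1 // expr1n.
Qed.

Lemma rnorm_mul_rl r x : rnorm (rl r * x) = `|r| * rnorm x.
Proof. by rewrite mul_rl rnormZr. Qed.

Lemma rnorm_rl r : rnorm (rl r) = `|r|.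
Proof. by rewrite -[rl r]mulr1 rnorm_mul_rl rnorm1 mulr1. Qed.

Lemma rnorm_le0 x : rnorm x <= 0 -> x = 0.
Proof. by move=> x0; apply/eqP; rewrite -rnorm_eq0 eq_le x0 rnorm_ge0. Qed.

End Basics.

(** * Limits of sequences in norm *)

Section Limits.
Variables (R : realType) (A : cstarAlgType R).
Implicit Types (x y z l m : A) (u v : nat -> A).

(** Convergence is expressed by real distances, so that limit theorems in [R] apply directly. *)
Definition rcvg u l := (fun n => rnorm (u n - l)) @ \oo --> (0 : R).

Lemma rcvg_squeeze u l (e : nat -> R) :
  (forall n, rnorm (u n - l) <= e n) -> e @ \oo --> (0 : R) -> rcvg u l.
Proof.
move=> ue e0; apply: (@squeeze_cvgr _ _ _ _ (fun=> 0) e) => //; last exact: cvg_cst.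
by apply: nearW => n; rewrite rnorm_ge0 ue.
Qed.

Lemma rcvg_cst l : rcvg (fun=> l) l.
Proof.
apply: (@rcvg_squeeze _ _ (fun=> 0)); last exact: cvg_cst.
by move=> n; rewrite subrr rnorm0.
Qed.

Lemma rcvgD u v l m : rcvg u l -> rcvg v m -> rcvg (fun n => u n + v n) (l + m).
Proof.
move=> ul vm; apply: (rcvg_squeeze (e := fun n => rnorm (u n - l) + rnorm (v n - m))).
  by move=> n; rewrite opprD addrACA rnormD.
by rewrite -[0 in X in _ --> X]addr0; exact: cvgD.
Qed.

Lemma rcvgM u v l m : rcvg u l -> rcvg v m -> rcvg (fun n => u n * v n) (l * m).
Proof.
move=> ul vm; apply: (rcvg_squeeze (e := fun n => rnorm (u n - l) *
    (rnorm (v n - m) + rnorm m) + rnorm l * rnorm (v n - m))).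
  move=> n; have -> : u n * v n - l * m = (u n - l) * v n + l * (v n - m).
    by rewrite mulrBl mulrBr addrA subrK.
  apply: (le_trans (rnormD _ _)); apply: lerD; last exact: rnormM.
  apply: (le_trans (rnormM _ _)); rewrite ler_wpM2l ?rnorm_ge0 //.
  by rewrite -[X in rnorm X <= _](subrK m) rnormD.
have -> : (0 : R) = 0 * (0 + rnorm m) + rnorm l * 0 by rewrite mul0r mulr0 addr0.
apply: cvgD; apply: cvgM => //; last exact: cvg_cst.
by apply: cvgD => //; exact: cvg_cst.
Qed.

Lemma rcvg_star u l : rcvg u l -> rcvg (fun n => star (u n)) (star l).
Proof.
by move=> ul; apply: (rcvg_squeeze _ ul) => n; rewrite -starB rnorm_star.
Qed.

Lemma rcvg_shift u l : rcvg u l -> rcvg (fun n => u n.+1) l.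
Proof. by move=> ul; rewrite /rcvg (cvg_shiftS (fun n => rnorm (u n - l))). Qed.

Lemma rcvg_unique u l m : rcvg u l -> rcvg u m -> l = m.
Proof.
move=> ul um; apply/eqP; rewrite -subr_eq0; apply/eqP/rnorm_le0.
have h : (fun n => rnorm (u n - l) + rnorm (u n - m)) @ \oo --> (0 : R).
  by rewrite -[0 in X in _ --> X]addr0; exact: cvgD.
rewrite -(cvg_lim _ h) //; apply: limr_ge; first by apply/cvg_ex; exists 0.
by apply: nearW => n; rewrite (rnormB (u n) l) (le_trans _ (rnormD _ _)) ?subrKA.
Qed.

Lemma rcvg_bound u l (M : R) : (forall n, rnorm (u n) <= M) -> rcvg u l -> rnorm l <= M.
Proof.
move=> uM ul.
have h : (fun n => rnorm (u n - l) + M) @ \oo --> M.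
  by rewrite -[M in X in _ --> X]add0r; apply: cvgD => //; exact: cvg_cst.
rewrite -[leRHS](cvg_lim _ h) //; apply: limr_ge; first by apply/cvg_ex; exists M.
apply: nearW => n; apply: (le_trans (_ : _ <= rnorm (u n - l) + rnorm (u n))).
  by rewrite -(rnormN (u n - l)) (le_trans _ (rnormD _ _)) // opprB subrK.
by rewrite lerD2l.
Qed.

(** The increments of [r] are nonnegative and telescope, so beyond an index where [r] is within [e]
    of its supremum [u] moves by less than [e]; completeness gives the limit. *)
Lemma majorized_rcvg u (r : nat -> R) M :
  (forall n, rnorm (u n.+1 - u n) <= r n.+1 - r n) -> (forall n, r n <= M) ->
  exists l, rcvg u l.
Proof.
move=> ur rM.
have ur2 n k : rnorm (u (n + k)%N - u n) <= r (n + k)%N - r n.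
  elim: k => [|k IH]; first by rewrite addn0 !subrr rnorm0.
  rewrite addnS -(subrKA (u (n + k)%N)) -(subrKA (r (n + k)%N) (r _.+1)).
  by rewrite (le_trans (rnormD _ _)) // lerD.
have hs : has_sup (range r) by split; [exists (r 0), 0%N|exists M => _ [n _ <-]].
have : cvgn u.
  apply/cauchy_cvgP/cauchy_exP => e e0.
  have eE : e = (complex.Re e)%:C by rewrite RRe_real // gtr0_real.
  have e0' : 0 < complex.Re e by rewrite -ltcR -eE.
  have [_ [n0 _ <-] hn0] := sup_adherent e0' hs.
  exists (u n0); exists n0 => // n /= n0n.
  rewrite -ball_normE /= normE eE ltcR rnormB -(subnKC n0n).
  rewrite (le_lt_trans (ur2 _ _)) // ltrBlDr -ltrBlDl.
  have rs := sup_upper_bound hs; move: (rs _ (imageP r (I : setT (n0 + (n - n0))%N))).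
  by move: hn0; lra.
move=> /cvg_ex[l ul]; exists l; apply/cvgrPdist_lt => e e0.
move/cvgrPdist_lt: ul => /(_ e%:C); rewrite ltcR => /(_ e0).
apply: filterS => n; rewrite normE ltcR rnormB sub0r normrN ger0_norm ?rnorm_ge0 //.
Qed.

End Limits.

(** * Square roots by iteration *)

Section SquareRoot.
Variables (R : realType) (A : cstarAlgType R).
Implicit Types (x y z h : A) (r : R).

Let half : A := rl A 2^-1.

Lemma half_add x : half * x + half * x = x.
Proof.
rewrite -mulrDl -rmorphD -[RHS]mul1r -(rmorph1 (rl A)); congr (rl A _ * x).
by field.
Qed.

(** A fixed point of [y -> (x + y^2) / 2] satisfies [(1 - y)^2 = 1 - x]. *)
Fixpoint sqrt_iter x n : A :=
  if n is m.+1 then half * (x + sqrt_iter x m ^+ 2) else 0.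

(** The scalar iteration at [x = 1], the extreme case of [|x| <= 1], serves as majorant. *)
Fixpoint real_iter n : R :=
  if n is m.+1 then 2^-1 * (1 + real_iter m ^+ 2) else 0.

Lemma real_iter_itv n : 0 <= real_iter n <= 1.
Proof. elim: n => [|n /andP[r0 r1]] /=; [lra | apply/andP; split; nra]. Qed.

Lemma rnorm_half x : rnorm (half * x) = 2^-1 * rnorm x.
Proof. by rewrite rnorm_mul_rl ger0_norm // invr_ge0. Qed.

Lemma sqrt_iter_le x n : rnorm x <= 1 -> rnorm (sqrt_iter x n) <= real_iter n.
Proof.
move=> x1; elim: n => [|n IH] /=; first by rewrite rnorm0.
rewrite rnorm_half ler_pM2l ?invr_gt0 // (le_trans (rnormD _ _)) // lerD //.
by rewrite (le_trans (rnormM _ _)) // expr2 ler_pM ?rnorm_ge0.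
Qed.

(** Each iterate is a fixed real polynomial in its argument. Taking [x1 = x2] gives commutation
    statements. *)
Lemma sqrt_iter_intertwine x1 x2 z n :
  z * x1 = x2 * z -> z * sqrt_iter x1 n = sqrt_iter x2 n * z.
Proof.
move=> zx; elim: n => [|n IH] /=; first by rewrite mulr0 mul0r.
rewrite mulrA (rlC 2^-1 z) -!mulrA; congr (_ * _).
by rewrite mulrDr mulrDl zx !expr2 mulrA IH -!mulrA IH.
Qed.

Lemma sqrt_iter_star x n : star (sqrt_iter x n) = sqrt_iter (star x) n.
Proof.
elim: n => [|n IH] /=; first exact: star0.
by rewrite starM star_rl (rlC 2^-1) starD starX IH.
Qed.

(** Consecutive iterates [u], [v] commute, so the next increment is [(u - v) (u + v) / 2]; the
    scalar increments obey the same recursion. *)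
Lemma sqrt_iter_step x n : rnorm x <= 1 ->
  rnorm (sqrt_iter x n.+1 - sqrt_iter x n) <= real_iter n.+1 - real_iter n.
Proof.
move=> x1; elim: n => [|n IH].
  rewrite subr0 /= subr0 !expr0n !addr0 rnorm_half; lra.
have cmm : GRing.comm (sqrt_iter x n.+1) (sqrt_iter x n).
  apply/esym/sqrt_iter_intertwine/esym/sqrt_iter_intertwine; by [].
have -> : sqrt_iter x n.+2 - sqrt_iter x n.+1 = half *
   ((sqrt_iter x n.+1 - sqrt_iter x n) * (sqrt_iter x n.+1 + sqrt_iter x n)).
  rewrite -[sqrt_iter x n.+2]/(half * (x + sqrt_iter x n.+1 ^+ 2)).
  rewrite [X in _ - X = _]/(half * (x + sqrt_iter x n ^+ 2)).
  move: cmm; set u := sqrt_iter x n.+1; set v := sqrt_iter x n => cmm.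
  rewrite -mulrBr [x + u ^+ 2]addrC addrKA; congr (_ * _).
  by rewrite mulrBl !mulrDr cmm addrKA -!expr2.
have -> : real_iter n.+2 - real_iter n.+1 = 2^-1 *
   ((real_iter n.+1 - real_iter n) * (real_iter n.+1 + real_iter n)).
  rewrite /=; ring.
rewrite rnorm_half ler_pM2l ?invr_gt0 // (le_trans (rnormM _ _)) //.
rewrite ler_pM ?rnorm_ge0 // (le_trans (rnormD _ _)) // lerD ?sqrt_iter_le //.
Qed.

(* The binomial series of [1 - sqrt (1 - x)]. *)
Definition sqrt_lim x : A := xget 0 [set l | rcvg (sqrt_iter x) l].

Lemma sqrt_lim_cvg x : rnorm x <= 1 -> rcvg (sqrt_iter x) (sqrt_lim x).
Proof.
move=> x1; rewrite /sqrt_lim; case: xgetP => [l -> //|nl].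
have [l ul] := majorized_rcvg (fun n => sqrt_iter_step n x1)
   (fun n => proj2 (andP (real_iter_itv n))).
by case: (nl l).
Qed.

Lemma sqrt_limP x : rnorm x <= 1 -> (1 - sqrt_lim x) ^+ 2 = 1 - x.
Proof.
move=> x1; have ul := sqrt_lim_cvg x1; set y := sqrt_lim x in ul *.
(* Pass to the limit in the recursion. *)
have yE : y = half * (x + y ^+ 2).
  apply: (rcvg_unique (rcvg_shift ul)); apply: rcvgM; first exact: rcvg_cst.
  by apply: rcvgD; [exact: rcvg_cst | rewrite expr2; exact: rcvgM].
have yy : y + y = x + y ^+ 2 by rewrite [in LHS]yE half_add.
have -> : x = y + (y - y ^+ 2) by rewrite addrA yy addrK.
by rewrite opprD addrA expr2 mulrBl mul1r mulrBr mulr1 -expr2.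
Qed.

Lemma sqrt_lim_le x : rnorm x <= 1 -> rnorm (sqrt_lim x) <= 1.
Proof.
move=> x1; apply: rcvg_bound (sqrt_lim_cvg x1) => n.
by rewrite (le_trans (sqrt_iter_le n x1)) //; case/andP: (real_iter_itv n).
Qed.

Lemma sqrt_lim_intertwine x1 x2 z : rnorm x1 <= 1 -> rnorm x2 <= 1 ->
  z * x1 = x2 * z -> z * sqrt_lim x1 = sqrt_lim x2 * z.
Proof.
move=> n1 n2 zx.
apply: (@rcvg_unique _ _ (fun n => z * sqrt_iter x1 n)).
  by apply: rcvgM; [exact: rcvg_cst | exact: sqrt_lim_cvg].
under eq_fun do rewrite (sqrt_iter_intertwine _ zx).
by apply: rcvgM; [exact: sqrt_lim_cvg | exact: rcvg_cst].
Qed.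

Lemma sqrt_lim_star x : rnorm x <= 1 -> star (sqrt_lim x) = sqrt_lim (star x).
Proof.
move=> x1; apply: (rcvg_unique (rcvg_star (sqrt_lim_cvg x1))).
under eq_fun do rewrite sqrt_iter_star.
by apply: sqrt_lim_cvg; rewrite rnorm_star.
Qed.

(* [h] is self-adjoint with spectrum in [0, 2r]. *)
Definition pos_within r h : Prop := star h = h /\ rnorm (rl A r - h) <= r.

Definition pos h : Prop := exists2 r, 0 < r & pos_within r h.

(** This is [sqrt r * sqrt (1 - (1 - h / r))]; the series applies because [|r - h| <= r] means
    [|1 - h / r| <= 1]. *)
Definition root r h : A := rl A (Num.sqrt r) * (1 - sqrt_lim (1 - rl A r^-1 * h)).

Lemma pos_within_scale r h : 0 < r -> rnorm (rl A r - h) <= r ->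
  rnorm (1 - rl A r^-1 * h) <= 1.
Proof.
move=> r0 hr; have -> : 1 - rl A r^-1 * h = rl A r^-1 * (rl A r - h).
  by rewrite mulrBr -rmorphM mulVf ?gt_eqF // rmorph1.
by rewrite rnorm_mul_rl gtr0_norm ?invr_gt0 // ler_pdivrMl // mulr1.
Qed.

Lemma root_sqr r h : 0 < r -> pos_within r h -> root r h ^+ 2 = h.
Proof.
move=> r0 [_ hr]; rewrite /root exprMn_comm; last by apply/commr_sym/rlC.
rewrite sqrt_limP ?pos_within_scale // -rmorphXn sqr_sqrtr ?ltW // subKr mulrA.
by rewrite -rmorphM mulfV ?gt_eqF // rmorph1 mul1r.
Qed.

Lemma root_star r h : 0 < r -> pos_within r h -> star (root r h) = root r h.
Proof.
move=> r0 [sh hr]; rewrite /root starM star_rl -(rlC (Num.sqrt r)) starB star1.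
rewrite sqrt_lim_star ?pos_within_scale // starB star1 starM star_rl sh.
by rewrite (rlC r^-1 h).
Qed.

(** The distance from [sqrt r] to the root is [sqrt r] times the norm of a limit [sqrt_lim], which
    is at most 1. *)
Lemma root_pos_within r h : 0 < r -> pos_within r h ->
  pos_within (Num.sqrt r) (root r h).
Proof.
move=> r0 hr; split; first exact: root_star.
rewrite /root mulrBr mulr1 subKr rnorm_mul_rl ger0_norm ?sqrtr_ge0 //.
by rewrite ler_piMr ?sqrtr_ge0 // sqrt_lim_le // pos_within_scale //; case: hr.
Qed.

(** The common radius [r] makes both roots values of the same series. *)
Lemma root_intertwine r h1 h2 z : 0 < r -> pos_within r h1 -> pos_within r h2 ->
  z * h1 = h2 * z -> z * root r h1 = root r h2 * z.
Proof.
move=> r0 [_ p1] [_ p2] zh; rewrite /root mulrA (rlC _ z) -!mulrA; congr (_ * _).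
rewrite mulrBr mulrBl mulr1 mul1r; congr (_ - _).
apply: sqrt_lim_intertwine; rewrite ?pos_within_scale //.
by rewrite mulrBr mulrBl mulr1 mul1r mulrA (rlC _ z) -!mulrA zh.
Qed.

End SquareRoot.

(** * The positive cone and its order *)

Section Positivity.
Variables (R : realType) (A : cstarAlgType R).
Implicit Types (a b c w x y z h : A) (r : R).

Notation rl := (@rl R A).

(* [b + i c] is a multiple of a unitary with real part [b]. *)
Lemma rnorm_sum_sqr b c r : star b = b -> star c = c -> GRing.comm b c ->
  b ^+ 2 + c ^+ 2 = rl r -> 0 <= r -> rnorm b ^+ 2 <= r.
Proof.
move=> sb sc bc bcr r0; pose i : R[i] := 'i%C.
have ii : i * i = -1 := mulii R.
have si : conjc i = - i := conjc_i R.
pose u := b + i *: c.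
have su : star u = b - i *: c by rewrite starD starZ si scaleNr sb sc.
have uu : star u * u = rl r.
  rewrite su mulrBl !mulrDr -!scalerAr -!scalerAl scalerA ii scaleN1r.
  by rewrite bc addrKA opprK -!expr2.
have nu : rnorm u ^+ 2 = r by rewrite -rnorm_cstar uu rnorm_rl ger0_norm.
have bE : b = rl 2^-1 * (u + star u).
  by rewrite su addrACA subrr addr0 mulrDr half_add.
rewrite -nu ler_sqr ?nnegrE ?rnorm_ge0 // bE rnorm_mul_rl ger0_norm ?invr_ge0 //.
by rewrite ler_pdivrMl // mulr_natl mulr2n (le_trans (rnormD _ _)) // rnorm_star.
Qed.

(** The element [r - b^2] lies in the cone, being at distance [|b|^2 <= r] from [r]. Its root [c]
    commutes with [b] and [c^2 + b^2 = r], so [|r - b^2| = |c|^2 <= r]. *)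
Lemma sqr_pos_within b r : star b = b -> 0 < r -> rnorm b ^+ 2 <= r ->
  pos_within r (b ^+ 2).
Proof.
move=> sb r0 br; split; first by rewrite starX sb.
have pc : pos_within r (rl r - b ^+ 2).
  by split; [rewrite starB star_rl starX sb | rewrite subKr rnorm_sa].
rewrite -(root_sqr r0 pc) rnorm_sa ?root_star //.
apply: (rnorm_sum_sqr (c := b)); rewrite ?root_star ?root_sqr ?ltW ?subrK //.
by apply/esym/root_intertwine => //; rewrite mulrBr mulrBl (rlC r b) -exprS -exprSr.
Qed.

Lemma pos_sa h : pos h -> star h = h.
Proof. by case=> r _ []. Qed.

Lemma pos_sqr b : star b = b -> pos (b ^+ 2).
Proof.
(* The [+ 1] keeps the radius positive when [b = 0]. *)
move=> sb; have b0 := sqr_ge0 (rnorm b); exists (rnorm b ^+ 2 + 1); first by lra.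
by apply: sqr_pos_within => //; lra.
Qed.

Lemma posD x y : pos x -> pos y -> pos (x + y).
Proof.
move=> [r r0 [sx rx]] [s s0 [sy ry]]; exists (r + s); first exact: addr_gt0.
split; first by rewrite starD sx sy.
by rewrite rmorphD opprD addrACA (le_trans (rnormD _ _)) // lerD.
Qed.

Lemma pos_subr x r : star x = x -> rnorm x <= r -> pos (rl r - x).
Proof.
move=> sx xr; have x0 := rnorm_ge0 x; exists (r + 1); first by lra.
split; first by rewrite starB star_rl sx.
rewrite rmorphD opprB [X in rnorm X](_ : _ = x + rl 1).
  by rewrite (le_trans (rnormD _ _)) // rmorph1 rnorm1 lerD2r.
by rewrite addrC addrA subrK.
Qed.

Lemma pos0 : pos (0 : A).
Proof. by exists 1 => //; split; rewrite ?star0 // subr0 rnorm_rl normr1. Qed.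

Lemma pos_mul_rl r x : 0 <= r -> pos x -> pos (rl r * x).
Proof.
rewrite le_eqVlt => /predU1P[<- _|r0 [s s0 [sx xs]]].
  by rewrite rmorph0 mul0r; exact: pos0.
exists (r * s); first exact: mulr_gt0.
split; first by rewrite starM star_rl sx (rlC r x).
by rewrite rmorphM -mulrBr rnorm_mul_rl gtr0_norm // ler_pM2l.
Qed.

(** The commutation clause is what replaces functional calculus in later arguments. *)
Lemma pos_sqrt h : pos h -> exists s,
  [/\ pos s, s ^+ 2 = h & forall z, GRing.comm z h -> GRing.comm z s].
Proof.
move=> [r r0 hr]; exists (root r h); split; last 2 first.
- exact: root_sqr.
- by move=> z zh; exact: root_intertwine.
by exists (Num.sqrt r); rewrite ?sqrtr_gt0 //; exact: root_pos_within.
Qed.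

(** The radius witnessing positivity can be any positive bound of the norm: write [h = s^2] with
    [|s|^2 = |h| <= r]. *)
Lemma pos_withinE h r : pos h -> 0 < r -> rnorm h <= r -> pos_within r h.
Proof.
move=> /pos_sqrt[s [/pos_sa ss <- _]] r0 hr.
by apply: sqr_pos_within => //; rewrite -rnorm_sa.
Qed.

(** Commuting roots [b] of [r - x] and [c] of [r + x] give [x^2 + (b c)^2 = r^2], and
    [rnorm_sum_sqr] bounds [|x|^2] by [r^2]. *)
Lemma rnorm_le_itv x r : 0 <= r -> star x = x -> pos (rl r - x) -> pos (rl r + x) ->
  rnorm x <= r.
Proof.
move=> r0 sx /pos_sqrt[b [/pos_sa sb b2 bC]] /pos_sqrt[c [/pos_sa sc c2 cC]].
have xC y : GRing.comm y x -> GRing.comm y b /\ GRing.comm y c.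
  move=> yx; have yr := rlC r y.
  by split; [apply: bC; exact: commrB | apply: cC; exact: commrD].
have [xb xc] := xC x erefl.
have [_ bc] := xC b (commr_sym xb).
suff : rnorm x ^+ 2 <= r ^+ 2 by rewrite ler_sqr ?nnegrE ?rnorm_ge0.
apply: (rnorm_sum_sqr (c := b * c)); rewrite ?sqr_ge0 ?starM ?sb ?sc //.
  exact: commrM.
rewrite exprMn_comm // b2 c2 mulrBl !mulrDr (rlC r x) rmorphXn addrKA -!expr2.
by rewrite addrC subrK.
Qed.

(** In the order of the cone, [- |y| <= 0 <= x <= y <= |y|]. *)
Lemma rnorm_mono x y : pos x -> pos (y - x) -> rnorm x <= rnorm y.
Proof.
move=> px pyx; have sy : star y = y by rewrite -(subrK x y) starD !pos_sa.
apply: rnorm_le_itv; rewrite ?rnorm_ge0 ?pos_sa //.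
  by rewrite -(subrK y (rl _)) -addrA; apply: posD => //; exact: pos_subr.
apply: posD => //; rewrite -[rl _]subr0.
by apply: pos_subr; rewrite ?star0 ?rnorm0 ?rnorm_ge0.
Qed.

Lemma pos_anti x : pos x -> pos (- x) -> x = 0.
Proof.
by move=> px nx; apply: rnorm_le0; rewrite -[leRHS](rnorm0 A) rnorm_mono ?sub0r.
Qed.

Lemma sqr_sa_eq0 x : star x = x -> x ^+ 2 = 0 -> x = 0.
Proof.
move=> sx x2; apply/eqP; rewrite -rnorm_eq0 -sqrf_eq0 -rnorm_sa // x2.
by rewrite rnorm0.
Qed.

End Positivity.

(** * Positivity of [a^* a], absolute values, inverses *)

Section StarPositivity.
Variables (R : realType) (A : cstarAlgType R).
Implicit Types (a b c w x y z h k : A) (r : R).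

Notation rl := (@rl R A).

Lemma sqrD_sum x y : (x + y) ^+ 2 = (x ^+ 2 + y ^+ 2) + (x * y + y * x).
Proof. by rewrite !expr2 mulrDl !mulrDr [y * x + _]addrC addrACA. Qed.

Lemma sqrB_sum x y : (x - y) ^+ 2 = (x ^+ 2 + y ^+ 2) - (x * y + y * x).
Proof. by rewrite sqrD_sum mulrN mulNr sqrrN -opprD. Qed.

(* Twice the sum is [(w + w^* )^2 + (i (w - w^* ))^2]. *)
Lemma pos_star_mulD w : pos (star w * w + w * star w).
Proof.
pose i : R[i] := 'i%C.
have ii : i * i = -1 := mulii R.
have si : conjc i = - i := conjc_i R.
have p1 : pos ((w + star w) ^+ 2) by apply: pos_sqr; rewrite starD starK addrC.
have p2 : pos ((i *: (w - star w)) ^+ 2).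
  by apply: pos_sqr; rewrite starZ starB starK si scaleNr -scalerN opprB.
have -> : star w * w + w * star w =
   rl 2^-1 * ((w + star w) ^+ 2 + (i *: (w - star w)) ^+ 2).
  rewrite (expr2 (i *: _)) -scalerAr -(scalerAl i) scalerA ii scaleN1r -expr2.
  rewrite sqrD_sum sqrB_sum opprB [X in _ * (_ + X)]addrC addrACA subrr add0r.
  by rewrite mulrDr half_add addrC.
by apply: pos_mul_rl; [rewrite invr_ge0 | exact: posD].
Qed.

(* With [q = w w^*] and [p = - w^* w], [(r + q) w = w (r - p)] for [r = |w|^2];
   the squared norm of this element is at most [r^3] by its right-hand side and
   at least [2 r^3] by its left-hand side. *)
Lemma star_mul_npos_eq0 w : pos (- (star w * w)) -> w = 0.
Proof.
set p := - _ => pp; pose q := w * star w; pose r := rnorm w ^+ 2.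
apply/eqP/negPn/negP; rewrite -rnorm_eq0 => w0.
have r0 : 0 < r by rewrite exprn_gt0 // lt_def w0 rnorm_ge0.
have pq : pos q.
  have -> : q = (star w * w + w * star w) + p by rewrite /p addrAC subrr add0r.
  by apply: posD => //; exact: pos_star_mulD.
have np : rnorm p = r by rewrite /p rnormN rnorm_cstar.
have nq : rnorm q = r by rewrite /q -{1}(starK w) rnorm_cstar rnorm_star.
pose v := (rl r + q) * w.
have vE : v = w * (rl r - p).
  by rewrite /v mulrDl mulrBr /p mulrN opprK (rlC r w) /q mulrA.
have vle : rnorm v ^+ 2 <= r ^+ 3.
  have [_ rp] : pos_within r p by apply: pos_withinE => //; rewrite np.
  rewrite -rnorm_cstar {1}vE vE starM -mulrA (mulrA (star w)).
  have -> : star (rl r - p) = rl r - p by rewrite starB star_rl pos_sa.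
  rewrite (le_trans (rnormM _ _)) // exprSr mulrC ler_pM ?rnorm_ge0 //.
  rewrite (le_trans (rnormM _ _)) // expr2 ler_pM ?rnorm_ge0 //.
  by rewrite -rnormN -/p np.
have vE2 : v * star v = rl (2 * r) * q ^+ 2 + (rl (r ^+ 2) * q + q ^+ 3).
  have -> : v * star v = (rl r + q) * q * (rl r + q).
    by rewrite /v starM starD star_rl (pos_sa pq) /q !mulrA.
  rewrite mulrDl -expr2 mulrDr (rlC r (_ + _)) mulrDr mulrDl -(mulrA _ q q).
  rewrite mulrA -rmorphM -!expr2 -exprSr (mulr_natl r) mulr2n rmorphD mulrDl.
  by rewrite [in LHS](addrC (rl (r ^+ 2) * q)) addrACA.
(* The remainder [r^2 q + q^3] is positive, so [v v^*] dominates [2 r q^2], whose norm is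
   [2 r^3]. *)
have : rnorm (rl (2 * r) * q ^+ 2) <= rnorm (v * star v).
  have pq2 : pos (q ^+ 2) by apply: pos_sqr; exact: pos_sa.
  apply: rnorm_mono; first by apply: pos_mul_rl => //; lra.
  rewrite vE2 [rl _ * _ + _]addrC addrK; apply: posD.
    exact: pos_mul_rl (sqr_ge0 _) _.
  have [s [/pos_sa ss sq sC]] := pos_sqrt pq.
  have -> : q ^+ 3 = (q * s) ^+ 2.
    by rewrite exprMn_comm ?sq -?exprSr //; apply: sC.
  by apply: pos_sqr; rewrite starM ss (pos_sa pq); apply/esym/sC.
rewrite -{1}(starK v) rnorm_cstar rnorm_star rnorm_mul_rl (rnorm_sa (pos_sa pq)) nq.
rewrite gtr0_norm; last by lra.
have : 0 < r ^+ 3 by exact: exprn_gt0.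
rewrite (exprS r 2) => h1 h2; move: vle; rewrite (exprS r 2); lra.
Qed.

(** Let [m] be the root of [x^2] and [n = m - x], twice the negative part of [x]. Since
    [x n = - m n], the element [- (a n)^* (a n) = n m n] is a square of a self-adjoint element, so
    [a n = 0]. Then [m n = 0], hence [n^2 = 0] and [x = m]. *)
Theorem star_mul_pos a : pos (star a * a).
Proof.
set x := star a * a.
have sx : star x = x by rewrite starM starK.
have [m [pm m2 mC]] := pos_sqrt (pos_sqr sx).
have xm : GRing.comm x m by apply: mC; exact: commrX.
have [s [/pos_sa ss s2 sC]] := pos_sqrt pm.
pose n := m - x.
have sn : star n = n by rewrite starB sx (pos_sa pm).
have nm : GRing.comm n m by apply/commr_sym/commrB => //; exact: commr_sym.
have ns : GRing.comm n s by exact: sC.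
have xn : x * n = - (m * n).
  by rewrite /n !mulrBr xm -(expr2 m) m2 expr2 opprB.
have sns : star (s * n) = s * n by rewrite starM ss sn ns.
have sn2 : (s * n) ^+ 2 = - (star (a * n) * (a * n)).
  rewrite starM sn -mulrA (mulrA (star a)) -/x xn mulrN opprK exprMn_comm //.
    by rewrite s2 expr2 !mulrA nm.
have an0 : a * n = 0.
  by apply: star_mul_npos_eq0; rewrite -sn2; exact: pos_sqr.
have mn0 : m * n = 0.
  rewrite -s2 expr2 -mulrA [s * n]sqr_sa_eq0 ?mulr0 //.
  by rewrite sn2 an0 mulr0 oppr0.
have n0 : n = 0.
  by apply: sqr_sa_eq0 => //; rewrite expr2 {1}/n mulrBl xn mn0 oppr0 subrr.
by move/eqP: n0; rewrite subr_eq0 => /eqP <-.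
Qed.

Lemma pos_conj h y : pos h -> pos (star y * h * y).
Proof.
move=> /pos_sqrt[s [/pos_sa ss <- _]].
rewrite expr2 mulrA -mulrA -{1}ss -starM; exact: star_mul_pos.
Qed.

(** The root of [h^2] from [pos_sqrt] commutes with both [h] and [k], which reduces to commuting
    [u], [v]. With [d = u - v], the positive elements [d u d] and [d v d] have sum
    [d (u + v) d = (u^2 - v^2) d = 0], so both vanish and [d^3 = 0]. *)
Lemma pos_sqr_inj h k : pos h -> pos k -> h ^+ 2 = k ^+ 2 -> h = k.
Proof.
suff key (u v : A) : pos u -> pos v -> GRing.comm u v -> u ^+ 2 = v ^+ 2 -> u = v.
  move=> ph pk hk; have [s [ps s2 sC]] := pos_sqrt (pos_sqr (pos_sa ph)).
  rewrite (key h s) // ?s2 //; last by apply: sC; exact: commrX.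
  by rewrite (key k s) // ?s2 ?hk //; apply: sC; rewrite hk; exact: commrX.
move=> pu pv uv u2v2; pose d := u - v.
have sd : star d = d by rewrite starB !pos_sa.
have pdu : pos (d * u * d) by rewrite -{1}sd; exact: pos_conj.
have pdv : pos (d * v * d) by rewrite -{1}sd; exact: pos_conj.
have dd0 : d * u * d + d * v * d = 0.
  rewrite -mulrDl -mulrDr [d * _](_ : _ = 0) ?mul0r //.
  by rewrite mulrBl !mulrDr uv addrKA -!expr2 u2v2 subrr.
have du0 : d * u * d = 0.
  apply: pos_anti => //; rewrite (_ : - _ = d * v * d) //.
  by apply/eqP; rewrite eq_sym -addr_eq0 addrC dd0.
have dv0 : d * v * d = 0 by rewrite -dd0 du0 add0r.
have d3 : d * (u - v) * d = 0 by rewrite (mulrBr d) mulrBl du0 dv0 subrr.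
have d0 : d = 0.
  apply: sqr_sa_eq0 => //; apply: sqr_sa_eq0; first by rewrite starX sd.
  by rewrite !expr2 !mulrA [d * d * d]d3 mul0r.
by apply/eqP; rewrite -subr_eq0 -/d d0.
Qed.

Lemma cstar_absP a : pos (cstar_abs a) /\ cstar_abs a ^+ 2 = star a * a.
Proof.
rewrite /cstar_abs /cstar_sqrt; case: xgetP => [b -> [[c ->] bb]|nb].
  by split=> //; exact: star_mul_pos.
(* The junk value is excluded: the root [s] is itself a square [t^2 = t^* t]. *)
have [s [ps s2 _]] := pos_sqrt (star_mul_pos a).
have [t [pt t2 _]] := pos_sqrt ps.
by case: (nb s); split=> //; exists t; rewrite pos_sa // -t2 expr2.
Qed.

(** The identity [a (a^* a) = (a a^* ) a] passes to roots taken with one common radius; uniqueness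
    of positive roots identifies these with the absolute values. *)
Lemma abs_intertwine a : a * cstar_abs a = cstar_abs (star a) * a.
Proof.
have [ph h2] := cstar_absP a; have [pk k2] := cstar_absP (star a).
rewrite starK in k2; pose r := rnorm a ^+ 2 + 1.
have r0 : 0 < r by have := sqr_ge0 (rnorm a); rewrite /r; lra.
have w1 : pos_within r (star a * a).
  by apply: pos_withinE => //; [exact: star_mul_pos | rewrite rnorm_cstar /r; lra].
have w2 : pos_within r (a * star a).
  rewrite -{1}(starK a); apply: pos_withinE => //; first exact: star_mul_pos.
  by rewrite rnorm_cstar rnorm_star /r; lra.
have rootE h x : pos h -> pos_within r x -> h ^+ 2 = x -> h = root r x.
  move=> p wx hx; apply: pos_sqr_inj => //; last by rewrite root_sqr.
  by exists (Num.sqrt r); rewrite ?sqrtr_gt0 //; exact: root_pos_within.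
rewrite (rootE _ _ ph w1 h2) (rootE _ _ pk w2 k2).
by apply: root_intertwine; rewrite // mulrA.
Qed.

(** The iterates [u] are the partial sums of the geometric series of [x], majorized by those of [t],
    which stay below [1 / (1 - t)]. *)
Lemma neumann x (t : R) : t < 1 -> rnorm x <= t ->
  exists y, y * (1 - x) = 1 /\ (1 - x) * y = 1.
Proof.
move=> t1 xt; have t0 : 0 <= t by exact: le_trans (rnorm_ge0 x) xt.
pose u := fix u n : A := if n is m.+1 then 1 + x * u m else 0.
pose v := fix v n : R := if n is m.+1 then 1 + t * v m else 0.
have uv n : rnorm (u n.+1 - u n) <= v n.+1 - v n.
  elim: n => [|n IH]; first by rewrite /= !subr0 !mulr0 !addr0 rnorm1.
  have -> : u n.+2 - u n.+1 = x * (u n.+1 - u n).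
    by rewrite mulrBr -[u n.+2]/(1 + _) -{2}[u n.+1]/(1 + _) [1 + _]addrC addrKA.
  have -> : v n.+2 - v n.+1 = t * (v n.+1 - v n) by rewrite /=; ring.
  by rewrite (le_trans (rnormM _ _)) // ler_pM ?rnorm_ge0.
have vle n : v n <= (1 - t)^-1.
  have t2 : 0 < 1 - t by rewrite subr_gt0.
  rewrite -(ler_pM2l t2) mulfV ?gt_eqF //.
  by elim: n => [|n IH] /=; nra.
have [y uy] := majorized_rcvg uv vle.
have ux n : u n * x = x * u n.
  elim: n => [|n IH] /=; first by rewrite mul0r mulr0.
  by rewrite mulrDl mulrDr mul1r mulr1 -mulrA IH.
have yx : y * x = x * y.
  apply: (@rcvg_unique _ _ (fun n => u n * x)).
    by apply: rcvgM => //; exact: rcvg_cst.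
  by under eq_fun do rewrite ux; apply: rcvgM => //; exact: rcvg_cst.
have yE : y = 1 + x * y.
  apply: (rcvg_unique (rcvg_shift uy)).
  by apply: rcvgD; [exact: rcvg_cst | apply: rcvgM => //; exact: rcvg_cst].
have y1 : y - x * y = 1 by rewrite {1}yE addrK.
by exists y; rewrite mulrBr mulrBl mulr1 mul1r yx.
Qed.

(** Factor [h + r = (t + r) (1 - (t - h) / (t + r))] with [|t - h| <= t < t + r] and use the Neumann
    series. The inverse [w] is self-adjoint, and positive since [w = w (h + r) w]. *)
Lemma pos_add_inv h r : pos h -> 0 < r -> exists y,
  [/\ pos y, y * (h + rl r) = 1, (h + rl r) * y = 1 &
      forall z, GRing.comm z h -> GRing.comm z y].
Proof.
move=> ph r0; have [t t0 [sh th]] := ph.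
have tr : 0 < t + r by lra.
have [y [yx xy]] : exists y, y * (1 - rl (t + r)^-1 * (rl t - h)) = 1 /\
   (1 - rl (t + r)^-1 * (rl t - h)) * y = 1.
  apply: (@neumann _ (t / (t + r))); first by rewrite ltr_pdivrMr //; lra.
  by rewrite rnorm_mul_rl gtr0_norm ?invr_gt0 // mulrC ler_pM2r ?invr_gt0.
have gE : 1 - rl (t + r)^-1 * (rl t - h) = rl (t + r)^-1 * (h + rl r).
  have {1}-> : 1 = rl (t + r)^-1 * rl (t + r).
    by rewrite -rmorphM mulVf ?gt_eqF // rmorph1.
  by rewrite -mulrBr; congr (_ * _); rewrite rmorphD opprB addrC addrA subrK.
pose w := rl (t + r)^-1 * y.
have wg : w * (h + rl r) = 1.
  by rewrite /w -(rlC _ y) -mulrA -gE.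
have gw : (h + rl r) * w = 1.
  by rewrite /w mulrA (rlC _ (h + _)) -gE.
have sg : star (h + rl r) = h + rl r by rewrite starD star_rl sh.
have sw : star w = w.
  by rewrite -[LHS]mulr1 -gw mulrA -{1}sg -starM gw star1 mul1r.
exists w; split=> //.
  rewrite -[w]mulr1 -gw mulrA -{1}sw; apply: pos_conj; apply: posD => //.
  by exists r => //; split; rewrite ?star_rl // subrr rnorm0 ltW.
move=> z zh; have zg : GRing.comm z (h + rl r) by apply: commrD => //; exact: rlC.
by rewrite /GRing.comm -[LHS]mul1r -wg -mulrA (mulrA _ z) -zg -!mulrA gw mulr1.
Qed.

(* With [g = |a| + r], this is the sum of [|a^*| - a g^-1 a^* >= 0] and
   [(a g^-1 - 1) g (a g^-1 - 1)^* >= 0]. *)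
Lemma abs_majorant a r : 0 < r ->
  pos (cstar_abs a + cstar_abs (star a) + rl r - (a + star a)).
Proof.
move=> r0; have [ph h2] := cstar_absP a; have [pk k2] := cstar_absP (star a).
have ahk := abs_intertwine a; rewrite starK in k2.
set h := cstar_abs a in ph h2 ahk *; set k := cstar_abs (star a) in pk k2 ahk *.
have [i [pi ig gi _]] := pos_add_inv ph r0.
have [j [pj jg gj jC]] := pos_add_inv pk r0.
have ja : j * a = a * i.
  have ag : a * (h + rl r) = (k + rl r) * a by rewrite mulrDr mulrDl ahk (rlC r a).
  by rewrite -[LHS]mulr1 -gi mulrA -(mulrA j) ag !mulrA jg mul1r.
(* Here [a i a^* = j a a^* = j k^2], and [j (k + r) = 1] gives [k = j k^2 + r j k]. *)
have aia : a * i * star a = k - rl r * (j * k).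
  have kE : k = j * (k * k) + rl r * (j * k).
    by rewrite -{1}[k]mul1r -jg mulrDr mulrDl (rlC r j) -!mulrA.
  by apply/eqP; rewrite -ja -mulrA -k2 expr2 eq_sym subr_eq -kE.
have p1 : pos (k - a * i * star a).
  rewrite aia subKr; apply: pos_mul_rl (ltW r0) _.
  (* For the root [t] of [k], which commutes with [j], one has [j k = t j t]. *)
  have [t [/pos_sa st t2 tC]] := pos_sqrt pk.
  have tk : GRing.comm t k by rewrite -t2; exact: commrX.
  rewrite -t2 expr2 mulrA -(jC t tk) -{1}st; exact: pos_conj.
pose e := a * i - 1.
have p2 : pos (e * (h + rl r) * star e).
  rewrite -{1}(starK e); apply: pos_conj; apply: posD => //.
  by exists r => //; split; rewrite ?star_rl // subrr rnorm0 ltW.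
have si : star i = i by exact: pos_sa.
have p2E : e * (h + rl r) * star e = (a * i * star a + (h + rl r)) - (a + star a).
  have eg : e * (h + rl r) = a - (h + rl r) by rewrite mulrBl mul1r -mulrA ig mulr1.
  have se : star e = i * star a - 1 by rewrite starB starM si star1.
  rewrite eg se mulrBr mulr1 mulrBl !mulrA gi mul1r.
  by rewrite opprB addrACA -opprD (addrC (star a)).
rewrite p2E in p2; have := posD p1 p2; congr pos.
by rewrite !addrA subrK (addrC k).
Qed.

End StarPositivity.

(** * States: positivity, Kadison's inequality, comparison with absolute values *)

Section States.
Variables (R : realType) (A : cstarAlgType R).
Implicit Types (a h x y : A) (f : {linear A -> R[i]^o}) (r : R).

Notation rl := (@rl R A).

Lemma rnormC_sqr (z : R[i]^o) :
  rnorm z ^+ 2 = complex.Re (z : R[i]) ^+ 2 + complex.Im (z : R[i]) ^+ 2.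
Proof. by apply: complexI; rewrite add_Re2_Im2 rmorphXn /= -normE. Qed.

Lemma ler_Re_rnorm (z : R[i]^o) : `|complex.Re (z : R[i])| <= rnorm z.
Proof.
rewrite -ler_sqr ?nnegrE ?rnorm_ge0 // rnormC_sqr real_normK ?num_real //.
by rewrite lerDl sqr_ge0.
Qed.

Lemma normC_conjc (z : R[i]) : `|z| ^+ 2 = z * conjc z.
Proof.
rewrite -add_Re2_Im2; case: z => p q; apply/eqP; rewrite eq_complex /=.
by apply/andP; split; apply/eqP; ring.
Qed.

Lemma unit_phase (z : R[i]^o) : exists c : R[i],
  [/\ c * conjc c = 1, `|c| = 1 & c * z = (rnorm z)%:C].
Proof.
have [->|z0] := eqVneq z 0.
  by exists 1; rewrite conjc1 mulr1 normr1 mulr0 rnorm0.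
pose n := rnorm z; have n0 : 0 < n by rewrite lt_def rnorm_eq0 z0 rnorm_ge0.
have zz : z * conjc z = (n ^+ 2)%:C by rewrite -normC_conjc rmorphXn /= /n -normE.
pose c : R[i] := n^-1%:C * conjc z.
have cz : c * z = n%:C.
  by rewrite /c -mulrA [_ * z]mulrC zz -rmorphM expr2 mulKf ?gt_eqF.
have cc : c * conjc c = 1.
  have -> : conjc c = n^-1%:C * z.
    rewrite /c; case: (z : R[i]) => u v; apply/eqP; rewrite eq_complex /=.
    by apply/andP; split; apply/eqP; ring.
  by rewrite mulrCA cz -rmorphM mulVf ?gt_eqF.
exists c; split=> //; apply/eqP; rewrite -sqrp_eq1 ?normr_ge0 //.
by rewrite normC_conjc cc.
Qed.

Lemma half_complex : (2^-1 : R[i]) = (2^-1 : R)%:C.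
Proof. by rewrite fmorphV rmorph_nat. Qed.

Lemma linearZ_state f (k : R[i]) x : f (k *: x) = k * (f x : R[i]) :> R[i].
Proof. by rewrite linearZ. Qed.

Lemma state_rl f r : states f -> f (rl r) = r%:C :> R[i].
Proof. by case=> _ f1 _; rewrite /rl linearZ_state f1 mulr1. Qed.

Lemma state_le f x : states f -> rnorm (f x) <= rnorm x.
Proof.
case=> _ _ f1; have [->|x0] := eqVneq x 0; first by rewrite linear0 !rnorm0.
have nx : 0 < rnorm x by rewrite lt_def rnorm_eq0 x0 rnorm_ge0.
(* The [sup] of a set without supremum is 0, so dual norm 1 forces boundedness. *)
have fs : has_sup [set rnorm (f x) | x in [set x | rnorm x <= 1]].
  apply/not_notP => nfs; move: f1; rewrite /dual_norm sup_out // => /eqP.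
  by rewrite eq_sym oner_eq0.
pose y := (rnorm x)^-1%:C *: x.
have ny : rnorm y <= 1 by rewrite rnormZr gtr0_norm ?invr_gt0 // mulVf ?gt_eqF.
have : rnorm (f y) <= dual_norm f by apply: (ub_le_sup fs.2); exists y.
rewrite f1 /y linearZ rnormZr gtr0_norm ?invr_gt0 //.
by rewrite ler_pdivrMl // mulr1.
Qed.

(* Compare [|f (x + i s)|^2 <= |x|^2 + s^2] for all real [s]. *)
Lemma state_sa f x : states f -> star x = x -> complex.Im (f x : R[i]) = 0.
Proof.
move=> sf sx; set b := complex.Im _; apply/eqP; apply/negPn/negP => b0.
(* With [b s = |x|^2], the inequality [(b + s)^2 <= |x|^2 + s^2] becomes [b^2 + |x|^2 <= 0]. *)
pose s := rnorm x ^+ 2 / b; pose i : R[i] := 'i%C.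
have ii : i * i = -1 := mulii R.
have si : conjc i = - i := conjc_i R.
pose y := x + i *: rl s.
have yy : star y * y = x ^+ 2 + rl (s ^+ 2).
  rewrite /y starD starZ si star_rl sx scaleNr mulrBl !mulrDr.
  rewrite -!(scalerAr i) -!(scalerAl i) (scalerA i i) ii scaleN1r (rlC s x).
  rewrite addrKA opprK.
  by rewrite expr2 rmorphXn expr2.
have := state_le y sf; rewrite -ler_sqr ?nnegrE ?rnorm_ge0 // -rnorm_cstar yy.
have -> : f y = (f x : R[i]) + i * s%:C :> R[i].
  by rewrite /y linearD linearZ_state state_rl.
move=> h; have := le_trans h (rnormD _ _).
rewrite rnorm_sa // rnorm_rl ger0_norm ?sqr_ge0 // rnormC_sqr.
have -> : complex.Im ((f x : R[i]) + i * s%:C) = b + s.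
  by rewrite raddfD /= /b !(mul0r, mul1r, mulr0, add0r, addr0).
have bs : b * s = rnorm x ^+ 2 by rewrite /s mulrC divfK.
have := sqr_ge0 (complex.Re ((f x : R[i]) + i * s%:C)).
have : 0 < b ^+ 2 by rewrite exprn_even_gt0.
have := sqr_ge0 (rnorm x); nra.
Qed.

(** The state is real on the self-adjoint elements [x + x^*] and [i (x - x^* )]; these two
    conditions determine its value at [x^*]. *)
Lemma state_star f x : states f -> f (star x) = conjc (f x : R[i]) :> R[i].
Proof.
move=> sf; pose i : R[i] := 'i%C.
have si : conjc i = - i := conjc_i R.
have h1 : star (x + star x) = x + star x by rewrite starD starK addrC.
have h2 : star (i *: (x - star x)) = i *: (x - star x).
  by rewrite starZ starB starK si scaleNr -scalerN opprB.
have := state_sa sf h1; have := state_sa sf h2.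
rewrite linearZ_state linearB linearD.
case: (f x : R[i]) => p q; case: (f (star x) : R[i]) => p' q' /= e1 e2.
by apply/eqP; rewrite eq_complex /=; apply/andP; split; apply/eqP; lra.
Qed.

Lemma state_sum f x : states f ->
  f (x + star x) = (complex.Re (f x : R[i]) *+ 2)%:C :> R[i].
Proof.
move=> sf; rewrite linearD state_star //; case: (f x : R[i]) => p q.
by apply/eqP; rewrite eq_complex /= subrr mulr2n !eqxx.
Qed.

(** [|r - f h| <= |r - h| <= r] keeps the real part of [f h] nonnegative. *)
Lemma state_pos f h : states f -> pos h -> 0 <= (f h : R[i]).
Proof.
move=> sf ph; rewrite lecE /= state_sa ?pos_sa // eqxx /=.
case: ph => r r0 [_ hr].
have := le_trans (ler_Re_rnorm _) (le_trans (state_le _ sf) hr).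
by rewrite linearB /= raddfB state_rl //= ler_norml; lra.
Qed.

(** Expand [f ((y - z)^* (y - z)) >= 0] at [z = f y]. *)
Lemma kadison f y : states f -> `|f y : R[i]| ^+ 2 <= (f (star y * y) : R[i]).
Proof.
move=> sf; set z := (f y : R[i]).
have := state_pos sf (star_mul_pos (y - z *: 1)).
rewrite starB starZ star1 mulrBl mulrBr -!scalerAr -!scalerAl mulr1 mul1r.
rewrite !(linearB, linearZ_state) state_star // -/z.
have -> : f 1 = 1 :> R[i] by case: sf.
by rewrite mulr1 subrr mulr0 subr0 subr_ge0 normC_conjc.
Qed.

Lemma abs_scale (c : R[i]) a : c * conjc c = 1 -> cstar_abs (c *: a) = cstar_abs a.
Proof.
move=> cc; rewrite /cstar_abs starZ -scalerAl -scalerAr scalerA.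
by rewrite [_ * c]mulrC cc scale1r.
Qed.

(** Rotating [a] by a unimodular [c] makes [f (c a) = |f a|] and preserves both absolute values.
    Applying [f] to [abs_majorant] gives [2 |f a| <= f p + e] for all [e > 0]. *)
Lemma state_abs_le f a : states f ->
  rnorm (f a) <= complex.Re (f (2^-1 *: (cstar_abs a + cstar_abs (star a))) : R[i]).
Proof.
move=> sf; pose p := cstar_abs a + cstar_abs (star a); pose n := rnorm (f a).
have [c [cc _ cz]] := unit_phase (f a); rewrite -/p -/n in cz *.
have le e : 0 < e -> n *+ 2 <= complex.Re (f p : R[i]) + e.
  move=> e0; have := state_pos sf (abs_majorant (c *: a) e0).
  rewrite starZ !abs_scale //; last by rewrite conjcK mulrC.
  rewrite -starZ -/p; move: (c *: a) (linearZ_state f c a) => ca; rewrite cz => fca.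
  rewrite linearB state_sum // lecE => /andP[_].
  by rewrite (linearD f p) state_rl // raddfB raddfD fca /= subr_ge0.
rewrite linearZ_state half_complex.
have : n *+ 2 <= complex.Re (f p : R[i]) by apply/ler_addgt0Pr => e /le.
by rewrite mulr2n; case: (f p : R[i]) => u v /=; lra.
Qed.

End States.

(** * The Hahn-Banach theorem for real-linear functionals *)

Section HahnBanach.
Variables (R : realType) (V : lmodType R[i]).
Implicit Types (p q : V -> R) (x y z : V) (s t : R).

Definition sublinear p :=
  (forall x y, p (x + y) <= p x + p y) /\
  (forall t x, 0 <= t -> p (t%:C *: x) <= t * p x).

Lemma sublinear0 p : sublinear p -> p 0 = 0.
Proof.
move=> [pD pZ]; apply/eqP; rewrite eq_le; apply/andP; split.
  by have := pZ 0 0 (lexx 0); rewrite scaler0 mul0r.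
by have := pD 0 0; rewrite addr0 -subr_ge0 addrK.
Qed.

Lemma sublinearN p x : sublinear p -> - p (- x) <= p x.
Proof.
move=> sp; rewrite lerNl -subr_ge0 opprK -(sublinear0 sp) -(addNr x).
exact: sp.1.
Qed.

Lemma sublinearZ p t x : sublinear p -> 0 <= t -> p (t%:C *: x) = t * p x.
Proof.
move=> sp; rewrite le_eqVlt => /predU1P[<-|t0].
  by rewrite scale0r mul0r sublinear0.
apply/eqP; rewrite eq_le (sp.2 _ _ (ltW t0)) /= -ler_pdivlMl //.
have t1 : 0 <= t^-1 by rewrite invr_ge0 ltW.
by have := sp.2 _ (t%:C *: x) t1; rewrite scalerA -rmorphM mulVf ?gt_eqF // scale1r.
Qed.

(* The sublinear functional [slope p y] is below [p] and linear on the line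
   spanned by [y], so that minimal sublinear functionals are linear. *)
Definition slope p y z : R :=
  inf [set p (z + t%:C *: y) - t * p y | t in [set t | 0 <= t]].

Lemma slope_has_inf p y z : sublinear p ->
  has_inf [set p (z + t%:C *: y) - t * p y | t in [set t | 0 <= t]].
Proof.
move=> sp; split; first by exists (p (z + 0%:C *: y) - 0 * p y), 0 => /=.
exists (- p (- z)) => _ [t /= t0 <-].
rewrite -(sublinearZ _ sp t0) lerBrDr addrC lerBlDr.
by rewrite -{1}(addKr z (t%:C *: y)) addrC sp.1.
Qed.

Lemma slope_le p y z t : sublinear p -> 0 <= t ->
  slope p y z <= p (z + t%:C *: y) - t * p y.
Proof.
by move=> sp t0; apply: (inf_lbound (slope_has_inf y z sp).2); exists t.
Qed.

Lemma slope_le_id p y z : sublinear p -> slope p y z <= p z.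
Proof.
by move=> sp; have := slope_le y z sp (lexx 0); rewrite scale0r addr0 mul0r subr0.
Qed.

(** Parameters [s] and [t] admissible for two points give [s + t] for their sum; scaling a point by
    [t > 0] turns [s] into [t s]. *)
Lemma slope_sublinear p y : sublinear p -> sublinear (slope p y).
Proof.
move=> sp; split=> [x z|t x].
  rewrite -lerBlDr [leRHS]/slope; apply: lb_le_inf.
    exact: (slope_has_inf y x sp).1.
  move=> _ [s /= s0 <-]; rewrite lerBlDr -lerBlDl.
  rewrite [leRHS]/slope; apply: lb_le_inf; first exact: (slope_has_inf y z sp).1.
  move=> _ [t /= t0 <-]; rewrite lerBlDr.
  apply: (le_trans (slope_le _ _ sp (addr_ge0 t0 s0))).
  have := sp.1 (x + s%:C *: y) (z + t%:C *: y).
  by rewrite addrACA -scalerDl -rmorphD [s + t]addrC; lra.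
rewrite le_eqVlt => /predU1P[<-|t0].
  by rewrite scale0r mul0r (le_trans (slope_le_id _ _ sp)) // sublinear0.
rewrite mulrC -ler_pdivrMr // [leRHS]/slope; apply: lb_le_inf.
  exact: (slope_has_inf y x sp).1.
move=> _ [s /= s0 <-]; rewrite ler_pdivrMr //.
apply: (le_trans (slope_le _ _ sp (mulr_ge0 (ltW t0) s0))).
rewrite rmorphM -scalerA -scalerDr (sublinearZ _ sp (ltW t0)); lra.
Qed.

(** Zorn's lemma, with the order reversed so that maximal means minimal. A nonempty chain is bounded
    by its pointwise infimum, finite because [q x >= - q (- x) >= - p (- x)]; the empty chain is
    bounded by [p]. *)
Lemma minimal_sublinear p : sublinear p -> exists q,
  [/\ sublinear q, forall x, q x <= p x &
      forall q', sublinear q' -> (forall x, q' x <= q x) -> forall x, q x <= q' x].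
Proof.
move=> sp; pose T := {q : V -> R | sublinear q /\ forall x, q x <= p x}.
pose below (q q' : T) := `[< forall x, sval q' x <= sval q x >].
have : exists q : T, premaximal (below : T -> T -> Prop) q.
  apply: (ZL_preorder (exist _ p (conj sp (fun x => lexx _)))).
  - by move=> q; apply/asboolP.
  - move=> r q q' /asboolP rq /asboolP qq'; apply/asboolP => x.
    exact: le_trans (qq' x) (rq x).
  - move=> C Ctot; have [[q0 Cq0]|C0] := pselect (exists q : T, C q); last first.
      by exists (exist _ p (conj sp (fun x => lexx _))) => q Cq; case: C0; exists q.
    pose I x := [set sval q x | q in C].
    have Inf x : has_inf (I x).
      split; first by exists (sval q0 x), q0.
      exists (- p (- x)) => _ [[q [sq qp]] _ <-] /=.
      by rewrite (le_trans _ (sublinearN x sq)) // lerN2.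
    have Ile x (q : T) : C q -> inf (I x) <= sval q x.
      by move=> Cq; apply: (inf_lbound (Inf x).2); exists q.
    have sI : sublinear (fun x => inf (I x)).
      split=> [x y|t x].
        rewrite -lerBlDr; apply: lb_le_inf; first exact: (Inf x).1.
        move=> _ [q Cq <-]; rewrite lerBlDr -lerBlDl.
        apply: lb_le_inf; first exact: (Inf y).1.
        move=> _ [q' Cq' <-]; rewrite lerBlDr.
        (* The smaller of the two chain members is used at both points. *)
        have [/asboolP qq'|/asboolP q'q] := Ctot _ _ Cq Cq'.
          apply: (le_trans (Ile _ _ Cq')); rewrite (le_trans ((svalP q').1.1 _ _)) //.
          by rewrite addrC lerD2l.
        apply: (le_trans (Ile _ _ Cq)); rewrite (le_trans ((svalP q).1.1 _ _)) //.
        by rewrite addrC lerD2r.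
      rewrite le_eqVlt => /predU1P[<-|t0].
        by rewrite scale0r mul0r (le_trans (Ile _ _ Cq0)) // (sublinear0 (svalP q0).1).
      rewrite mulrC -ler_pdivrMr //; apply: lb_le_inf; first exact: (Inf x).1.
      move=> _ [q Cq <-]; rewrite ler_pdivrMr // mulrC.
      by apply: (le_trans (Ile _ _ Cq)); exact: (svalP q).1.2 _ _ (ltW t0).
    have Ip x : inf (I x) <= p x by exact: le_trans (Ile x q0 Cq0) ((svalP q0).2 x).
    exists (exist _ (fun x => inf (I x)) (conj sI Ip)) => q Cq.
    by apply/asboolP => x /=; exact: Ile.
move=> [[q [sq qp]] qmin].
exists q; split=> // q' sq' q'q.
have q'p x : q' x <= p x by exact: le_trans (q'q x) (qp x).
have /asboolP := qmin (exist _ q' (conj sq' q'p)) (asboolT q'q); exact.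
Qed.

(** Take [g] minimal below [slope p x]. Minimality gives [g y <= slope g z y <= g (y + z) - g z],
    hence additivity. Starting from the slope instead of [p] gives [g (- x) <= - p x], which forces
    equality at [x]. *)
Theorem hahn_banach p x : sublinear p -> exists g : V -> R,
  [/\ {morph g : y z / y + z}, forall t y, g (t%:C *: y) = t * g y,
      forall y, g y <= p y & g x = p x].
Proof.
move=> sp; have [g [sg gp gmin]] := minimal_sublinear (slope_sublinear x sp).
have gp' y : g y <= p y := le_trans (gp y) (slope_le_id x y sp).
have gD : {morph g : y z / y + z}.
  move=> y z; apply/eqP; rewrite eq_le sg.1 /= -lerBrDr.
  apply: (le_trans (gmin _ (slope_sublinear z sg) (fun w => slope_le_id z w sg) y)).
  by have := slope_le z y sg ler01; rewrite scale1r mul1r.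
have gN y : g (- y) = - g y by apply/eqP; rewrite -addr_eq0 -gD addNr sublinear0.
exists g; split=> // [t y|].
  have [t0|t0] := leP 0 t; first exact: sublinearZ.
  by rewrite -[t]opprK rmorphN scaleNr gN sublinearZ ?mulNr // oppr_ge0 ltW.
apply/eqP; rewrite eq_le gp' /= -lerN2 -gN (le_trans (gp _)) //.
have := slope_le x (- x) sp ler01.
by rewrite scale1r mul1r addNr (sublinear0 sp) sub0r.
Qed.

End HahnBanach.

(** * Norming states and the numerical radius *)

Section NormingState.
Variables (R : realType) (A : cstarAlgType R).
Implicit Types (a h x y : A) (r : R).

Notation rl := (@rl R A).

Lemma sublinear_rnorm : sublinear (@rnorm R A).
Proof.
by split=> [x y|t x t0]; [exact: rnormD | rewrite rnormZr ger0_norm].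
Qed.

(** Complex linearity forces the imaginary part at [y] to be minus the real part at [i y]. *)
Lemma complexify (g : A -> R) : {morph g : x y / x + y} ->
  (forall t y, g (t%:C *: y) = t * g y) ->
  exists F : {linear A -> R[i]^o}, forall y, complex.Re (F y : R[i]) = g y.
Proof.
move=> gD gZ; pose F y : R[i]^o := Complex (g y) (- g ('i%C *: y)).
have gN y : g (- y) = - g y.
  by rewrite -scaleN1r -(rmorphN1 (real_complex R)) gZ mulN1r.
have gk k y : g (k *: y) = complex.Re k * g y + complex.Im k * g ('i%C *: y).
  rewrite {1}[k]complexE scalerDl gD gZ; congr (_ + _).
  by rewrite -gZ scalerA mulrC.
have FL : linear F.
  move=> k y z; apply/eqP; rewrite eq_complex; apply/andP; split; apply/eqP.
    rewrite raddfD /= gD gk; case: k => s t /=; ring.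
  rewrite raddfD /= scalerDr gD scalerA mulrC -scalerA gk scalerA -expr2 sqr_i.
  rewrite scaleN1r gN; case: k => s t /=; ring.
pose FM := GRing.isLinear.Build R[i] A R[i]^o _ F FL.
pose FS : {linear A -> R[i]^o} := HB.pack F FM.
by exists FS.
Qed.

(** Rotating [y] until [F y] is real turns the bound on [g] into [|F y| <= |y|]. Then [|F 1| <= 1]
    with real part 1 forces [F 1 = 1], where the dual norm is attained. *)
Lemma state_of_real (g : A -> R) : {morph g : x y / x + y} ->
  (forall t y, g (t%:C *: y) = t * g y) ->
  (forall y, g y <= rnorm y) -> g 1 = 1 ->
  exists2 F : {linear A -> R[i]^o}, states F & forall y, complex.Re (F y : R[i]) = g y.
Proof.
move=> gD gZ gle g1; have [F FE] := complexify gD gZ; exists F => //.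
have Fle y : rnorm (F y) <= rnorm y.
  have [c [_ nc cz]] := unit_phase (F y).
  have := gle (c *: y); rewrite -FE linearZ_state cz rnormZ nc mul1r.
  by [].
have F1 : F 1 = 1.
  have := Fle 1; rewrite rnorm1 -(ler_sqr) ?nnegrE ?rnorm_ge0 // rnormC_sqr FE g1.
  move=> h; apply/eqP; rewrite eq_complex FE g1 eqxx /= -sqrf_eq0 eq_le sqr_ge0.
  by rewrite andbT; lra.
split=> //.
  move=> x; apply/cvgrPdist_lt => e e0; near=> y; rewrite -linearB.
  apply: (@le_lt_trans _ _ `|x - y|); first by rewrite normE [leRHS]normE lecR.
  by near: y; exact: cvgr_dist_lt.
rewrite /dual_norm; set S := [set _ | _ in _].
have S1 : S 1 by exists 1; rewrite /= ?rnorm1 // F1 /rnorm normr1.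
have ubS : ubound S 1 by move=> _ [y /= y1 <-]; exact: le_trans (Fle y) y1.
apply/eqP; rewrite eq_le; apply/andP; split; first by apply: ge_sup; first by exists 1.
by apply: ub_le_sup => //; exists 1.
Unshelve. all: by end_near.
Qed.

(** Otherwise the larger norm [m] is below [2 r]; both [m - r - x] and [m - r + x] are positive, so
    [r = |x| <= m - r < r]. *)
Lemma rnorm_extremal x : star x = x ->
  rnorm (rl (rnorm x) + x) = rnorm x *+ 2 \/ rnorm (rl (rnorm x) - x) = rnorm x *+ 2.
Proof.
move=> sx; pose r := rnorm x; have r0 : 0 <= r := rnorm_ge0 x.
have sN : star (- x) = - x by rewrite starN sx.
have le2 y : rnorm y = r -> rnorm (rl r + y) <= r *+ 2.
  by move=> yr; rewrite (le_trans (rnormD _ _)) // rnorm_rl ger0_norm // yr -mulr2n.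
apply: contrapT => /not_orP[/eqP n1 /eqP n2].
have {}n1 : rnorm (rl r + x) < r *+ 2 by rewrite lt_neqAle n1 le2.
have {}n2 : rnorm (rl r - x) < r *+ 2 by rewrite lt_neqAle n2 le2 // rnormN.
pose m := Num.max (rnorm (rl r + x)) (rnorm (rl r - x)).
have m2 : m < r *+ 2 by rewrite gt_max n1 n2.
have mp y : star y = y -> rnorm (rl r + y) <= m -> pos (rl (m - r) - y).
  move=> sy ym; rewrite rmorphB -addrA -opprD; apply: pos_subr => //.
  by rewrite starD star_rl sy.
have mr : 0 <= m - r.
  have := rnormD (rl r + x) (rl r - x).
  rewrite addrACA subrr addr0 -rmorphD rnorm_rl (ger0_norm (addr_ge0 r0 r0)).
  have : rnorm (rl r + x) <= m by rewrite le_max lexx.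
  have : rnorm (rl r - x) <= m by rewrite le_max lexx orbT.
  lra.
have : r <= m - r.
  apply: rnorm_le_itv => //; first by apply: mp => //; rewrite le_max lexx.
  by rewrite -[x in rl _ + x]opprK; apply: mp => //; rewrite le_max lexx orbT.
by rewrite lerBrDr -mulr2n leNgt m2.
Qed.

(** For [y = x] or [y = - x], let [g] norm [|x| + y]. Then [|x| g 1 + g y = 2 |x|] with [g 1 <= 1]
    and [g y <= |x|], so both are equalities. *)
Lemma norming_state x : star x = x ->
  exists2 f : {linear A -> R[i]^o}, states f & rnorm x = `|complex.Re (f x : R[i])|.
Proof.
move=> sx; have [x0|x0] := eqVneq x 0.
  (* For [x = 0] any state will do; a functional norming 1 provides one. *)
  have [g [gD gZ gle g1]] := hahn_banach 1 sublinear_rnorm.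
  have [|f sf _] := state_of_real gD gZ gle _; first by rewrite g1 rnorm1.
  by exists f => //; rewrite x0 linear0 rnorm0 normr0.
have nx : 0 < rnorm x by rewrite lt_def rnorm_eq0 x0 rnorm_ge0.
suff key (y : A) : rnorm y = rnorm x -> rnorm (rl (rnorm x) + y) = rnorm x *+ 2 ->
    exists2 f : {linear A -> R[i]^o}, states f & complex.Re (f y : R[i]) = rnorm x.
  have [h|h] := rnorm_extremal sx.
    by have [f sf fx] := key x erefl h; exists f => //; rewrite fx ger0_norm ?rnorm_ge0.
  have [f sf] := key _ (rnormN x) h; rewrite linearN raddfN /= => fx.
  by exists f => //; rewrite -normrN fx ger0_norm ?rnorm_ge0.
move=> ny nz.
have [g [gD gZ gle gz]] := hahn_banach (rl (rnorm x) + y) sublinear_rnorm.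
have gy := gle y; have g1 := gle 1.
rewrite gD /rl gZ nz in gz; rewrite ny in gy; rewrite rnorm1 in g1.
have g11 : g 1 = 1 by nra.
have [f sf fE] := state_of_real gD gZ gle g11.
by exists f => //; rewrite fE; nra.
Qed.

Lemma radius_le a (m : R) : 0 <= m ->
  (forall f : {linear A -> R[i]^o}, states f -> rnorm (f a) <= m) ->
  alg_numerical_radius a <= m.
Proof.
move=> m0 fm; rewrite /alg_numerical_radius.
have [->|/set0P S0] := eqVneq [set rnorm (f a) | f in @states R A] set0.
  by rewrite sup0.
by apply: ge_sup => // _ [f sf <-]; exact: fm.
Qed.

Lemma state_le_radius (f : {linear A -> R[i]^o}) a : states f ->
  rnorm (f a) <= alg_numerical_radius a.
Proof.
move=> sf; apply: ub_le_sup; last by exists f.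
by exists (rnorm a) => _ [g sg <-]; exact: state_le.
Qed.

Lemma radius_ge0 a : 0 <= alg_numerical_radius a.
Proof.
have [f sf _] := norming_state (star0 A).
exact: le_trans (rnorm_ge0 _) (state_le_radius a sf).
Qed.

Lemma radius_star a : alg_numerical_radius (star a) = alg_numerical_radius a.
Proof.
have le (b : A) : alg_numerical_radius b <= alg_numerical_radius (star b).
  apply: radius_le => [|f sf]; first exact: radius_ge0.
  rewrite (le_trans _ (state_le_radius _ sf)) // state_star //.
  rewrite -ler_sqr ?nnegrE ?rnorm_ge0 // !rnormC_sqr.
  by case: (f b : R[i]) => u v /=; rewrite sqrrN.
by apply/eqP; rewrite eq_le le -{2}(starK a) le.
Qed.

(** A state norming the self-adjoint real part takes there the value [Re (f a)]. *)
Lemma rnorm_re_part_le a : rnorm (re_part a) <= alg_numerical_radius a.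
Proof.
have sr : star (re_part a) = re_part a.
  by rewrite /re_part starZ starD starK addrC half_complex conjc_real.
have [f sf ->] := norming_state sr.
apply: le_trans (state_le_radius a sf); apply: le_trans (ler_Re_rnorm _).
rewrite /re_part linearZ_state half_complex state_sum //= mul0r subr0.
by rewrite -[X in _ * X]mulr_natl mulKf ?pnatr_eq0.
Qed.

End NormingState.

(** * Bounds for the squared numerical radius *)

Section SquaredBounds.
Variables (R : realType) (A : cstarAlgType R).
Implicit Types a : A.

Let mean a : A := 2^-1 *: (cstar_abs a + cstar_abs (star a)).

Lemma mean_sa a : star (mean a) = mean a.
Proof.
by rewrite /mean starZ half_complex conjc_real starD !(pos_sa (cstar_absP _).1).
Qed.

Lemma state_mean_le (f : {linear A -> R[i]^o}) a : states f ->
  `|f a : R[i]| ^+ 2 <= (f (mean a ^+ 2) : R[i]).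
Proof.
move=> sf; apply: (@le_trans _ _ (`|f (mean a) : R[i]| ^+ 2)); last first.
  by have := kadison (mean a) sf; rewrite mean_sa.
rewrite !(@normE _ R[i]^o) -!rmorphXn lecR ler_sqr ?nnegrE ?rnorm_ge0 //.
by rewrite (le_trans (state_abs_le a sf)) // (le_trans (ler_norm _)) // ler_Re_rnorm.
Qed.

Lemma state_interpolation_le (f : {linear A -> R[i]^o}) a (t : R) : states f ->
  0 <= t <= 1 ->
  `|f a : R[i]| ^+ 2 <=
    (f (t%:C *: mean a ^+ 2 + (1 - t)%:C *: cstar_abs a ^+ 2) : R[i]).
Proof.
move=> sf /andP[t0 t1]; rewrite linearD !linearZ_state (cstar_absP a).2.
(* Split [|f a|^2] with weights [t] and [1 - t] and bound each part separately. *)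
rewrite -[leLHS]mul1r -{1}(subrK t%:C 1) addrC mulrDl.
rewrite -(rmorph1 (real_complex R)) -rmorphB.
apply: lerD; rewrite ler_wpM2l ?ler0c ?subr_ge0 //; last exact: kadison.
exact: state_mean_le.
Qed.

Lemma radius_sqr_le a y :
  (forall f : {linear A -> R[i]^o}, states f ->
    `|f a : R[i]| ^+ 2 <= (f y : R[i])) ->
  alg_numerical_radius a ^+ 2 <= rnorm y.
Proof.
move=> h; have y0 := rnorm_ge0 y.
rewrite -[leRHS]sqr_sqrtr // ler_sqr ?nnegrE ?sqrtr_ge0 ?radius_ge0 //.
apply: radius_le => [|f sf]; first exact: sqrtr_ge0.
rewrite -ler_sqr ?nnegrE ?sqrtr_ge0 ?rnorm_ge0 // sqr_sqrtr //.
rewrite (le_trans _ (state_le y sf)) // (le_trans _ (ler_Re_rnorm _)) //.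
rewrite (le_trans _ (ler_norm _)) //.
by have := h f sf; rewrite (@normE _ R[i]^o) -rmorphXn lecE => /andP[].
Qed.

(** The cross terms are [h k + k h = 2 Re (h k)], since [(h k)^* = k h]. *)
Lemma mean_sqr a : mean a ^+ 2 =
  2^-1 *: re_part (cstar_abs a * cstar_abs (star a))
  + 4^-1 *: (star a * a + a * star a).
Proof.
have [ph h2] := cstar_absP a; have [pk k2] := cstar_absP (star a).
rewrite starK in k2.
have e4 : (4^-1 : R[i]) = 2^-1 * 2^-1 by rewrite -invfM -natrM.
rewrite /mean /re_part starM (pos_sa ph) (pos_sa pk) expr2 -scalerAl -scalerAr scalerA.
by rewrite -(expr2 (_ + _)) sqrD_sum h2 k2 e4 scalerA -scalerDr addrC.
Qed.

End SquaredBounds.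

Theorem theorem3p9 (R : realType) (A : cstarAlgType R) (a : A) :
  [/\ (forall f : {linear A -> R[i]^o}, states f ->
        forall t : R, 0 <= t <= 1 ->
        `|(f a : R[i])| ^+ 2 <=
          (f (t%:C *: (2^-1 *: (cstar_abs a + cstar_abs (star a))) ^+ 2
              + (1 - t)%:C *: cstar_abs a ^+ 2) : R[i])),
      (forall t : R, 0 <= t <= 1 ->
        alg_numerical_radius a ^+ 2 <=
          rnorm (t%:C *: (2^-1 *: (cstar_abs a + cstar_abs (star a))) ^+ 2
                 + (1 - t)%:C *: cstar_abs a ^+ 2)),
      (forall t : R, 0 <= t <= 1 ->
        alg_numerical_radius a ^+ 2 <=
          rnorm (t%:C *: (2^-1 *: (cstar_abs a + cstar_abs (star a))) ^+ 2
                 + (1 - t)%:C *: cstar_abs (star a) ^+ 2)) &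
      alg_numerical_radius a ^+ 2 <=
        2^-1 * rnorm (re_part (cstar_abs a * cstar_abs (star a)))
        + 4^-1 * rnorm (star a * a + a * star a) <=
        2^-1 * alg_numerical_radius (cstar_abs a * cstar_abs (star a))
        + 4^-1 * rnorm (star a * a + a * star a)].
Proof.
have interp (b : A) (t : R) : 0 <= t <= 1 -> alg_numerical_radius b ^+ 2 <=
    rnorm (t%:C *: (2^-1 *: (cstar_abs b + cstar_abs (star b))) ^+ 2
           + (1 - t)%:C *: cstar_abs b ^+ 2).
  by move=> t01; apply: radius_sqr_le => f sf; exact: state_interpolation_le.
split; [| exact: interp | |].
- by move=> f sf t t01; exact: state_interpolation_le.
(* Replacing [a] by [a^*] swaps the absolute values and preserves the radius. *)
- move=> t t01; have := interp (star a) t t01.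
  by rewrite starK radius_star [_ + cstar_abs a]addrC.
- apply/andP; split; last by rewrite lerD2r ler_pM2l ?invr_gt0 // rnorm_re_part_le.
  apply: le_trans (radius_sqr_le (fun f sf => state_mean_le a sf)) _.
  have e4 : (4^-1 : R[i]) = (4^-1 : R)%:C by rewrite fmorphV rmorph_nat.
  by rewrite mean_sqr (le_trans (rnormD _ _)) // half_complex e4 !rnormZr
    !ger0_norm ?invr_ge0.
Qed.
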